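(* Let $1\le p\le n-1$. Then the Rees quotient $RQ_p(n)$ is a non-regular $0$-$^*$bisimple abundant semigroup.
   Context: Let $[n]=\{1,\dots,n\}$ with its usual order. A partial transformation of $[n]$ is a function $\rho$ whose domain $\mathrm{Dom}\,\rho$ and image $\mathrm{Im}\,\rho$ are subsets of $[n]$ (the empty map is allowed). Maps are written on the right and composed left to right: $x(\rho\sigma)=(x\rho)\sigma$. $\rho$ is isotone if $x\le y$ implies $x\rho\le y\rho$ for all $x,y\in\mathrm{Dom}\,\rho$; antitone if $x\le y$ implies $x\rho\ge y\rho$; monotone if isotone or antitone; decreasing if $x\rho\le x$ for all $x\in\mathrm{Dom}\,\rho$. $\mathcal{DORP}_n$ is the monoid, under composition, of all monotone and decreasing partial transformations of $[n]$. The height of $\rho$ is $|\mathrm{Im}\,\rho|$. For $0\le p\le n-1$, $I(n,p)=\{\rho\in\mathcal{DORP}_n:|\mathrm{Im}\,\rho|\le p\}$, a two-sided ideal. For $p\ge1$, $RQ_p(n)=I(n,p)/I(n,p-1)$ is the Rees quotient: its nonzero elements are the elements of $\mathcal{DORP}_n$ of height exactly $p$, and a product of two of them is their composite if that has height $p$ and is the zero $\mathbf{0}$ otherwise. On a semigroup $S$, $\mathcal{L}^*=\{(a,b)\in S\times S:\ \forall x,y\in S^1,\ ax=ay\iff bx=by\}$, $\mathcal{R}^*=\{(a,b)\in S\times S:\ \forall x,y\in S^1,\ xa=ya\iff xb=yb\}$, and $\mathcal{D}^*$ is the join of $\mathcal{L}^*$ and $\mathcal{R}^*$ in the lattice of equivalence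 relations. A semigroup is regular if for every $x\in S$ there is $y\in S$ with $x=xyx$. A non-regular semigroup is abundant if each of its $\mathcal{L}^*$-classes and each of its $\mathcal{R}^*$-classes contains an idempotent. A semigroup with zero $\mathbf{0}$ is $0$-$^*$bisimple if it has a unique nonzero $\mathcal{D}^*$-class. *)

(* Defs.v *)
From HB Require Import structures.
From mathcomp Require Import all_boot all_fingroup.
From Stdlib Require Import Relation_Definitions.

Set Implicit Arguments.
Unset Strict Implicit.
Unset Printing Implicit Defensive.

Local Open Scope group_scope.

Section StarRelations.
Variable S : semigroupType.
Implicit Types (a b e z : S) (x y : option S).

Definition is_identity e : Prop := forall a, e * a = a /\ a * e = a.

Definition is_zero z : Prop := forall a, z * a = z /\ a * z = z.

(* The elements of S^1 are the [x : option S] satisfying [in_S1 x]: [Some s]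
   stands for s, and [None] for the identity adjoined when S has none. *)
Definition in_S1 x : Prop :=
  if x is None then ~ (exists e, is_identity e) else True.

Definition mulS1r a x : S := if x is Some s then a * s else a.
Definition mulS1l x a : S := if x is Some s then s * a else a.

Definition Lstar : relation S := fun a b =>
  forall x y, in_S1 x -> in_S1 y ->
    (mulS1r a x = mulS1r a y <-> mulS1r b x = mulS1r b y).

Definition Rstar : relation S := fun a b =>
  forall x y, in_S1 x -> in_S1 y ->
    (mulS1l x a = mulS1l y a <-> mulS1l x b = mulS1l y b).

(* The join of L* and R*, as the least equivalence relation containing both. *)
Definition Dstar : relation S := fun a b =>
  forall E : relation S, equivalence S E ->
    inclusion S Lstar E -> inclusion S Rstar E -> E a b.

Definition is_class (E : relation S) (C : S -> Prop) : Prop :=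
  exists a, forall b, C b <-> E a b.

Definition regular_semigroup : Prop := forall a, exists b, a = a * b * a.

Definition has_idempotent (C : S -> Prop) : Prop := exists2 e, C e & e * e = e.

Definition abundant : Prop :=
  [/\ ~ regular_semigroup,
      forall C, is_class Lstar C -> has_idempotent C
    & forall C, is_class Rstar C -> has_idempotent C].

Definition nonzero_class z (C : S -> Prop) : Prop := ~ (forall b, C b <-> b = z).

Definition zero_star_bisimple : Prop :=
  exists2 z, is_zero z &
  exists C : S -> Prop,
    [/\ is_class Dstar C, nonzero_class z C
      & forall C', is_class Dstar C' -> nonzero_class z C' ->
          forall b, C' b <-> C b].

End StarRelations.

Arguments regular_semigroup : clear implicits.
Arguments abundant : clear implicits.
Arguments zero_star_bisimple : clear implicits.

(* The chain {1 < ... < n} is represented by 'I_n = {0 < ... < n-1};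
   [rho x = None] means that x is outside the domain of rho. *)
Definition ptrans (n : nat) := {ffun 'I_n -> option 'I_n}.

Section PartialTransformations.
Variable n : nat.
Implicit Types rho sigma tau : ptrans n.

Definition pim rho : {set 'I_n} := [set y | [exists x, rho x == Some y]].

Definition isotone rho : bool :=
  [forall x, forall y, forall u, forall v,
     [&& rho x == Some u, rho y == Some v & (x <= y)%N] ==> (u <= v)%N].

Definition antitone rho : bool :=
  [forall x, forall y, forall u, forall v,
     [&& rho x == Some u, rho y == Some v & (x <= y)%N] ==> (v <= u)%N].

Definition monotone rho : bool := isotone rho || antitone rho.

Definition decreasing rho : bool :=
  [forall x, forall u, (rho x == Some u) ==> (u <= x)%N].

(* Maps act on the right: x (rho sigma) = (x rho) sigma. *)
Definition pcomp rho sigma : ptrans n := [ffun x => obind sigma (rho x)].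

Definition pid : ptrans n := [ffun x => Some x].

Lemma pcompA : associative pcomp.
Proof.
move=> r s t; apply/ffunP => x; rewrite !ffunE.
by case: (r x) => //= y; rewrite ffunE.
Qed.

Lemma pcomp1r : left_id pid pcomp.
Proof. by move=> r; apply/ffunP => x; rewrite !ffunE. Qed.

Lemma pcompr1 : right_id pid pcomp.
Proof.
by move=> r; apply/ffunP => x; rewrite !ffunE; case: (r x) => //= y; rewrite ffunE.
Qed.

Lemma isotoneP rho :
  reflect (forall x y u v, rho x = Some u -> rho y = Some v ->
             (x <= y)%N -> (u <= v)%N)
          (isotone rho).
Proof.
apply: (iffP idP) => [/'forall_'forall_'forall_'forall_implyP h x y u v hx hy xy|h].
  by apply: (h x y u v); rewrite hx hy !eqxx.
apply/'forall_'forall_'forall_'forall_implyP => x y u v.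
by case/and3P=> /eqP hx /eqP hy; apply: h hx hy.
Qed.

Lemma antitoneP rho :
  reflect (forall x y u v, rho x = Some u -> rho y = Some v ->
             (x <= y)%N -> (v <= u)%N)
          (antitone rho).
Proof.
apply: (iffP idP) => [/'forall_'forall_'forall_'forall_implyP h x y u v hx hy xy|h].
  by apply: (h x y u v); rewrite hx hy !eqxx.
apply/'forall_'forall_'forall_'forall_implyP => x y u v.
by case/and3P=> /eqP hx /eqP hy; apply: h hx hy.
Qed.

Lemma decreasingP rho :
  reflect (forall x u, rho x = Some u -> (u <= x)%N) (decreasing rho).
Proof.
apply: (iffP idP) => [/'forall_'forall_implyP h x u hx|h].
  by apply: h; rewrite hx.
by apply/'forall_'forall_implyP => x u /eqP; apply: h.
Qed.

Lemma pcomp_Some rho sigma x v :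
  pcomp rho sigma x = Some v -> exists2 u, rho x = Some u & sigma u = Some v.
Proof. by rewrite ffunE; case: (rho x) => //= u; exists u. Qed.

Lemma monotone_pcomp rho sigma :
  monotone rho -> monotone sigma -> monotone (pcomp rho sigma).
Proof.
case/orP=> hr /orP[] hs; apply/orP.
- left; apply/isotoneP => x y u v /pcomp_Some[u' xu uu] /pcomp_Some[v' yv vv] xy.
  exact: (isotoneP _ hs) uu vv (isotoneP _ hr _ _ _ _ xu yv xy).
- right; apply/antitoneP => x y u v /pcomp_Some[u' xu uu] /pcomp_Some[v' yv vv] xy.
  exact: (antitoneP _ hs) uu vv (isotoneP _ hr _ _ _ _ xu yv xy).
- right; apply/antitoneP => x y u v /pcomp_Some[u' xu uu] /pcomp_Some[v' yv vv] xy.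
  exact: (isotoneP _ hs) vv uu (antitoneP _ hr _ _ _ _ xu yv xy).
- left; apply/isotoneP => x y u v /pcomp_Some[u' xu uu] /pcomp_Some[v' yv vv] xy.
  exact: (antitoneP _ hs) vv uu (antitoneP _ hr _ _ _ _ xu yv xy).
Qed.

Lemma decreasing_pcomp rho sigma :
  decreasing rho -> decreasing sigma -> decreasing (pcomp rho sigma).
Proof.
move=> /decreasingP hr /decreasingP hs; apply/decreasingP => x u.
by case/pcomp_Some=> v /hr vx /hs uv; apply: leq_trans uv vx.
Qed.

Lemma monotone_pid : monotone pid.
Proof.
by apply/orP; left; apply/isotoneP => x y u v; rewrite !ffunE => -[<-] [<-].
Qed.

Lemma decreasing_pid : decreasing pid.
Proof. by apply/decreasingP => x u; rewrite ffunE => -[<-]. Qed.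

Lemma card_pim_pcompl rho sigma : #|pim (pcomp rho sigma)| <= #|pim rho|.
Proof.
pose f y := odflt y (sigma y).
apply: leq_trans (leq_imset_card f (mem (pim rho))).
apply/subset_leq_card/subsetP => v; rewrite inE => /existsP[x /eqP].
case/pcomp_Some=> u xu uv; apply/imsetP; exists u; last by rewrite /f uv.
by rewrite inE; apply/existsP; exists x; rewrite xu.
Qed.

Lemma card_pim_pcompr rho sigma : #|pim (pcomp rho sigma)| <= #|pim sigma|.
Proof.
apply/subset_leq_card/subsetP => v; rewrite !inE => /existsP[x /eqP].
by case/pcomp_Some=> u _ uv; apply/existsP; exists u; rewrite uv.
Qed.

End PartialTransformations.

Record dorp (n : nat) := Dorp {
  dorp_val :> ptrans n;
  dorpP : monotone dorp_val && decreasing dorp_val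
}.

HB.instance Definition _ n := [isSub for @dorp_val n].
HB.instance Definition _ n := [Finite of dorp n by <:].

Section DorpMonoid.
Variable n : nat.

Lemma dorp_mul_subproof (r s : dorp n) :
  monotone (pcomp r s) && decreasing (pcomp r s).
Proof.
have /andP[mr dr] := dorpP r; have /andP[ms ds] := dorpP s.
by rewrite monotone_pcomp ?decreasing_pcomp.
Qed.

Definition dorp_mul (r s : dorp n) : dorp n := Dorp (dorp_mul_subproof r s).

Lemma dorp_one_subproof : monotone (pid n) && decreasing (pid n).
Proof. by rewrite monotone_pid decreasing_pid. Qed.

Definition dorp_one : dorp n := Dorp dorp_one_subproof.

Lemma dorp_mulA : associative dorp_mul.
Proof. by move=> r s t; apply/val_inj/pcompA. Qed.

Lemma dorp_mul1r : left_id dorp_one dorp_mul.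
Proof. by move=> r; apply/val_inj/pcomp1r. Qed.

Lemma dorp_mulr1 : right_id dorp_one dorp_mul.
Proof. by move=> r; apply/val_inj/pcompr1. Qed.

HB.instance Definition _ := isSemigroup.Build (dorp n) dorp_mulA.
HB.instance Definition _ :=
  Semigroup_isMonoid.Build (dorp n) dorp_mul1r dorp_mulr1.

Definition height (r : dorp n) : nat := #|pim r|.

Lemma height_mull (r s : dorp n) : height (r * s) <= height r.
Proof. exact: card_pim_pcompl. Qed.

Lemma height_mulr (r s : dorp n) : height (r * s) <= height s.
Proof. exact: card_pim_pcompr. Qed.

End DorpMonoid.

(* RQ_p(n) = I(n,p) / I(n,p-1), for p >= 1: [Some r] is the element r of height
   exactly p, and [None] is the zero. *)
Definition RQ (p n : nat) := option {r : dorp n | height r == p}.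

HB.instance Definition _ p n := Finite.on (RQ p n).

Section ReesQuotient.
Variables p n : nat.

Definition RQ_zero : RQ p n := None.

(* [insub t] is [Some t] if t has height p, and [None] otherwise. *)
Definition RQ_mul (a b : RQ p n) : RQ p n :=
  match a, b with
  | Some r, Some s => insub (val r * val s)
  | _, _ => RQ_zero
  end.

Lemma RQ_mulA : associative RQ_mul.
Proof.
case=> [r|] [s|] [t|] //=; last by case: insub.
case: (insubP _ (val s * val t)) => [st _ est|hst];
case: (insubP _ (val r * val s)) => [rs _ ers|hrs] //=.
- by rewrite est ers mulgA.
- rewrite est mulgA insubN //; apply: contra hrs => /eqP e.
  have le_rs_p := height_mull (val r) (val s); rewrite (eqP (valP r)) in le_rs_p.
  by rewrite eqn_leq le_rs_p -[X in _ && (X <= _)]e height_mull.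
- rewrite ers -mulgA insubN //; apply: contra hst => /eqP e.
  have le_st_p := height_mulr (val s) (val t); rewrite (eqP (valP t)) in le_st_p.
  by rewrite eqn_leq le_st_p -[X in _ && (X <= _)]e height_mulr.
Qed.

HB.instance Definition _ := isSemigroup.Build (RQ p n) RQ_mulA.

End ReesQuotient.

(* Main.v *)
(** Two elements of height [p] that are L- (resp. R-) related in the monoid of
    all partial transformations are L*- (resp. R*-) related in [RQ p n]: the
    witnessing multipliers preserve both equality and height.  Hence the L*-class
    of [r] contains the identity on its image, and the R*-class of [r] contains the
    idempotent sending each point to the least point of its kernel class.
    Composing [r] with the ranking of its image gives an element R*-related to [r]
    with image [{0, ..., p-1}], so any two nonzero elements are D*-related.
    Finally, since maps are decreasing, an element whose image contains [0] and
    whose domain does not is never regular. *)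

From mathcomp Require Import all_boot all_fingroup.
From Stdlib Require Import Relation_Definitions.
Require Import Defs.

Set Implicit Arguments.
Unset Strict Implicit.
Unset Printing Implicit Defensive.

Local Open Scope group_scope.

(** * Star relations in a semigroup with zero *)

Section StarTheory.
Variable S : semigroupType.
Implicit Types a b c z : S.

Lemma Lstar_Dstar a b : Lstar a b -> Dstar a b.
Proof. by move=> ab E _ LE _; apply: LE. Qed.

Lemma Rstar_Dstar a b : Rstar a b -> Dstar a b.
Proof. by move=> ab E _ _ RE; apply: RE. Qed.

Lemma Dstar_sym a b : Dstar a b -> Dstar b a.
Proof. by move=> ab E eqE LE RE; apply: (equiv_sym _ _ eqE); apply: ab. Qed.

Lemma Dstar_trans a b c : Dstar a b -> Dstar b c -> Dstar a c.
Proof.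
move=> ab bc E eqE LE RE.
by apply: (equiv_trans _ _ eqE) (ab E eqE LE RE) (bc E eqE LE RE).
Qed.

Lemma Lstar_sym a b : Lstar a b -> Lstar b a.
Proof. by move=> ab x y hx hy; apply: iff_sym; apply: ab. Qed.

Lemma Rstar_sym a b : Rstar a b -> Rstar b a.
Proof. by move=> ab x y hx hy; apply: iff_sym; apply: ab. Qed.

(** All products [z * x] equal [z], so [a * x = a * y] for all [x] and [y]. Taking [y = z] and for
    [x] an identity, one of [S] or else the adjoined one, gives [a = z]. *)
Lemma Lstar_zero z a : is_zero z -> Lstar z a -> a = z.
Proof.
move=> z0 za; apply/eqP/negPn/negP => /eqP a_neq.
have noid : in_S1 (None : option S).
  move=> [e ide]; apply: a_neq; have [_ <-] := ide a; have [_ <-] := z0 a.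
  by apply/(za (Some e) (Some z)) => //=; rewrite !(z0 _).1.
apply: a_neq; have [_ <-] := z0 a.
by apply/(za None (Some z)) => //=; rewrite !(z0 _).1.
Qed.

Lemma Rstar_zero z a : is_zero z -> Rstar z a -> a = z.
Proof.
move=> z0 za; apply/eqP/negPn/negP => /eqP a_neq.
have noid : in_S1 (None : option S).
  move=> [e ide]; apply: a_neq; have [<- _] := ide a; have [<- _] := z0 a.
  by apply/(za (Some e) (Some z)) => //=; rewrite !(z0 _).2.
apply: a_neq; have [<- _] := z0 a.
by apply/(za None (Some z)) => //=; rewrite !(z0 _).2.
Qed.

Lemma Dstar_zero z a : is_zero z -> Dstar z a -> a = z.
Proof.
move=> z0 za; have [] // : z = z <-> a = z; last by move=> h _; apply: h.
(* The equivalence with classes [{z}] and its complement contains [Lstar] and [Rstar], hence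
   [Dstar]. *)
apply: (za (fun b c => b = z <-> c = z)).
- split=> [b|b c d bc cd|b c bc] //; first exact: iff_trans bc cd.
  exact: iff_sym.
- move=> b c bc; split=> e; subst; first exact: Lstar_zero bc.
  exact: (Lstar_zero z0 (Lstar_sym bc)).
- move=> b c bc; split=> e; subst; first exact: Rstar_zero bc.
  exact: (Rstar_zero z0 (Rstar_sym bc)).
Qed.

End StarTheory.

(** Abstracts multiplication by two related elements of a Rees quotient: [f] and [g] multiply before
    truncation, [insub] sends a product of the wrong height to zero, and [None] is the zero
    multiplier. *)
Lemma obind_insub_transfer (T : Type) (P : pred T) (sT : subType P)
    (f g : T -> T) :
    (forall t, P (f t) = P (g t)) -> (forall t u, f t = f u -> g t = g u) ->
  forall x y : option T,
    obind (fun t => insub (f t) : option sT) x = obind (fun t => insub (f t)) y ->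
    obind (fun t => insub (g t) : option sT) x = obind (fun t => insub (g t)) y.
Proof.
move=> Pfg fg.
have None_fg t : insub (f t) = None :> option sT -> insub (g t) = None :> option sT.
  by case: insubP => // nP _; rewrite insubN -?Pfg.
case=> [t|] [u|] //=; last by move/esym/None_fg => ->.
  case: (insubP sT (f t)) => [s Ps es|nP e]; last first.
    by rewrite !insubN -?Pfg //; case: insubP e.
  by case: insubP => // s' Ps' es' [ss']; rewrite (fg t u) // -es -es' ss'.
exact: None_fg.
Qed.

(** * Images of partial maps and restrictions of the identity *)

Section PartialMaps.
Variable n : nat.
Implicit Types (r s f g : ptrans n) (A : {set 'I_n}).

Lemma pimP r y : reflect (exists x, r x = Some y) (y \in pim r).
Proof.
by rewrite inE; apply: (iffP existsP) => -[x e]; exists x; apply/eqP.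
Qed.

Lemma pim_sub_pcomp r s : pim r \subset pim s -> exists f : ptrans n, r = pcomp f s.
Proof.
move=> /subsetP rs.
exists [ffun x => obind (fun u => [pick z | s z == Some u]) (r x)].
apply/ffunP => x; rewrite !ffunE; case rx: (r x) => [u|] //=.
case: pickP => [z /eqP //|no]; have /pimP[z sz] : u \in pim s.
  by apply: rs; apply/pimP; exists x.
by have := no z; rewrite sz eqxx.
Qed.

Definition pid_on A : ptrans n := [ffun x => if x \in A then Some x else None].

Lemma pim_pid_on A : pim (pid_on A) = A.
Proof.
apply/setP => y; apply/pimP/idP => [[x]|yA]; last by exists y; rewrite ffunE yA.
by rewrite ffunE; case: ifP => // xA [<-].
Qed.

Lemma pid_on_dorp A : monotone (pid_on A) && decreasing (pid_on A).
Proof.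
apply/andP; split; last first.
  by apply/decreasingP => x u; rewrite ffunE; case: ifP => // _ [->].
apply/orP; left; apply/isotoneP => x y u v; rewrite !ffunE.
by do 2![case: ifP => // _ [<-]].
Qed.

Lemma pid_on_idem A : pcomp (pid_on A) (pid_on A) = pid_on A.
Proof.
by apply/ffunP => x; rewrite !ffunE; case: ifP => //= xA; rewrite ffunE xA.
Qed.

(** * Idempotents attached to kernels *)

Definition least_preim r : ptrans n :=
  [ffun v => [pick z | (r z == Some v) && [forall y, (r y == Some v) ==> (z <= y)]]].

(** For decreasing [r], [least_preim r] never moves a point down, yet this composite is decreasing:
    [x] is itself among the points over which the minimum is taken. *)
Definition kernel_min r : ptrans n := pcomp r (least_preim r).

Variant kernel_min_spec r (x : 'I_n) : option 'I_n -> option 'I_n -> Prop :=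
  | KernelMinNone : kernel_min_spec r x None None
  | KernelMinSome v m of r x = Some v & r m = Some v
      & (forall y, r y = Some v -> m <= y) : kernel_min_spec r x (Some v) (Some m).

Lemma kernel_minP r x : kernel_min_spec r x (r x) (kernel_min r x).
Proof.
rewrite /kernel_min ffunE; case rx: (r x) => [v|] /=; last by constructor.
rewrite ffunE; case: pickP => [m /andP[/eqP rm /forallP min_m]|no].
  by constructor=> // y ry; have := min_m y; rewrite ry eqxx.
(* The fibre of [v] contains [x], so it has a least point and the pick cannot fail. *)
have : r x == Some v by rewrite rx.
move/(@arg_minnP _ x (fun z => r z == Some v) (fun z : 'I_n => z : nat)).
case=> m rm min_m; have := no m; rewrite rm /= => /forallP[] y.
by apply/implyP; apply: min_m.
Qed.

Lemma kernel_min_comp r : pcomp (kernel_min r) r = r.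
Proof.
apply/ffunP => x; rewrite ffunE.
by case: (kernel_minP r x) => [|v m _ rm _] //=.
Qed.

Lemma kernel_min_idem r : pcomp (kernel_min r) (kernel_min r) = kernel_min r.
Proof. by rewrite {2}/kernel_min pcompA kernel_min_comp. Qed.

Lemma kernel_min_dorp r :
  monotone r && decreasing r -> monotone (kernel_min r) && decreasing (kernel_min r).
Proof.
move=> /andP[mr _]; apply/andP; split; last first.
  apply/decreasingP => x u; case: (kernel_minP r x) => // v m rx _ min_m [<-].
  exact: min_m.
apply/orP; left; apply/isotoneP => x y u w.
case: (kernel_minP r x) => // v1 m1 rx rm1 min1 [<-].
case: (kernel_minP r y) => // v2 m2 ry rm2 min2 [<-] xy.
rewrite leqNgt; apply/negP => lt21.
have m1y : m1 <= y by apply: leq_trans (min1 _ rx) xy.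
suff : m1 <= m2 by rewrite leqNgt lt21.
apply: min1.
(* [r] is monotone with equal values at [m2 < m1 <= x <= y], hence constant there. *)
rewrite rm2; congr Some; apply/val_inj/eqP; rewrite eqn_leq.
case/orP: mr => [/isotoneP|/antitoneP] mono.
  by rewrite (mono _ _ _ _ rm2 rm1 (ltnW lt21)) (mono _ _ _ _ rm1 ry m1y).
by rewrite (mono _ _ _ _ rm2 rm1 (ltnW lt21)) (mono _ _ _ _ rm1 ry m1y).
Qed.

(** * Ranking of a subset of the chain *)

Lemma card_below A (v : 'I_n) : #|[set u in A | u < v]| <= v.
Proof.
rewrite cardE -(size_map val) -[leqRHS](size_iota 0).
apply: uniq_leq_size; first by rewrite (map_inj_uniq val_inj) enum_uniq.
by move=> k /mapP[u]; rewrite mem_enum inE mem_iota => /andP[_ uv] ->.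
Qed.

(** Ranks count from 0. The bound by [v] makes the rank a point of the chain and [ranking A]
    decreasing. *)
Definition rank_in A v : 'I_n := Ordinal (leq_ltn_trans (card_below A v) (ltn_ord v)).

Lemma rank_in_lt A (u v : 'I_n) : u \in A -> u < v -> rank_in A u < rank_in A v.
Proof.
move=> uA uv; apply/proper_card/properP; split.
  by apply/subsetP => w; rewrite !inE => /andP[-> /ltn_trans]; apply.
by exists u; rewrite !inE uA ?ltnn.
Qed.

Lemma rank_in_le A (u v : 'I_n) : v \in A -> u <= v -> rank_in A u <= rank_in A v.
Proof.
move=> vA uv; apply/subset_leq_card/subsetP => w.
by rewrite !inE => /andP[->] /leq_trans->.
Qed.

Lemma rank_in_inj A : {in A &, injective (rank_in A)}.
Proof.
move=> u v uA vA /(congr1 val)/= e; apply/val_inj; case: (ltngtP u v) => // lt.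
  by have := rank_in_lt uA lt; rewrite /= e ltnn.
by have := rank_in_lt vA lt; rewrite /= e ltnn.
Qed.

Definition ranking A : ptrans n :=
  [ffun v => if v \in A then Some (rank_in A v) else None].

Lemma pim_ranking A : pim (ranking A) = rank_in A @: A.
Proof.
apply/setP => y; apply/pimP/imsetP => [[x]|[x xA ->]]; last by exists x; rewrite ffunE xA.
by rewrite ffunE; case: ifP => // xA [<-]; exists x.
Qed.

Lemma card_pim_ranking A : #|pim (ranking A)| = #|A|.
Proof. by rewrite pim_ranking card_in_imset //; apply: rank_in_inj. Qed.

Lemma pim_ranking_segment A : pim (ranking A) = [set i : 'I_n | i < #|A|].
Proof.
apply/eqP; rewrite eqEcard; apply/andP; split.
  rewrite pim_ranking; apply/subsetP => _ /imsetP[x xA ->]; rewrite inE.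
  (* The point [x] lies in [A] but not below itself, so its rank is strictly less than [#|A|]. *)
  apply/proper_card/properP; split; last by exists x; rewrite // !inE ltnn andbF.
  by apply/subsetP => u; rewrite inE => /andP[].
rewrite card_pim_ranking cardE -(size_map val) -[leqRHS](size_iota 0).
apply: uniq_leq_size; first by rewrite (map_inj_uniq val_inj) enum_uniq.
by move=> k /mapP[u]; rewrite mem_enum inE mem_iota => ? ->.
Qed.

Lemma ranking_dorp A : monotone (ranking A) && decreasing (ranking A).
Proof.
apply/andP; split; last first.
  apply/decreasingP => x u; rewrite ffunE; case: ifP => // _ [<-].
  exact: card_below.
apply/orP; left; apply/isotoneP => x y u v; rewrite !ffunE.
case: ifP => // _ [<-]; case: ifP => // yA [<-]; exact: rank_in_le.
Qed.

(** Ranks are injective on the image of [r], so [g] can return each rank to its point. *)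
Lemma ranking_cancel r :
  exists g : ptrans n, r = pcomp (pcomp r (ranking (pim r))) g.
Proof.
exists [ffun w => [pick v in pim r | rank_in (pim r) v == w]].
apply/ffunP => x; rewrite !ffunE; case rx: (r x) => [v|] //=.
have v_im : v \in pim r by apply/pimP; exists x.
rewrite ffunE v_im /= ffunE; case: pickP => [w /andP[w_im /eqP e]|no].
  by rewrite (rank_in_inj w_im v_im e).
by have := no v; rewrite v_im eqxx.
Qed.

Lemma pim_comp_ranking r : pim (pcomp r (ranking (pim r))) = pim (ranking (pim r)).
Proof.
apply/setP => y; apply/pimP/pimP => [[x /pcomp_Some[u _ uy]]|[u]]; first by exists u.
rewrite ffunE; case: ifP => // u_im [<-]; have /pimP[x rx] := u_im.
by exists x; rewrite ffunE rx /= ffunE u_im.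
Qed.

End PartialMaps.

(** * Heights of products *)

Section DorpHeight.
Variable n : nat.
Implicit Types (r s t : dorp n) (f : ptrans n).

Lemma dorp_valM r s : r * s = pcomp r s :> ptrans n.
Proof. by []. Qed.

(** Composing with [f] on the left can only shrink the image. Applied in both directions, this gives
    products of equal height. *)
Lemma height_mul_pcompl r s f t :
  r = pcomp f s :> ptrans n -> height (r * t) <= height (s * t).
Proof. by move=> rs; rewrite /height !dorp_valM rs -pcompA card_pim_pcompr. Qed.

Lemma height_mul_pcompr r s f t :
  r = pcomp s f :> ptrans n -> height (t * r) <= height (t * s).
Proof. by move=> rs; rewrite /height !dorp_valM rs pcompA card_pim_pcompl. Qed.

End DorpHeight.

(** * Star relations in the Rees quotient *)

Section ReesTheory.
Variables p n : nat.
Implicit Types (r s : {r : dorp n | height r == p}) (a b : RQ p n).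

Lemma RQ_zeroP : is_zero (RQ_zero p n).
Proof. by case. Qed.

(* The adjoined identity acts as the identity map, whatever its height. *)
Definition lift1 (x : option (RQ p n)) : option (dorp n) :=
  if x is Some a then omap val a else Some 1.

Lemma mulS1rE r x :
  mulS1r (Some r : RQ p n) x = obind (fun t => insub (val r * t)) (lift1 x).
Proof. by case: x => [[s|]|] //=; rewrite mulg1 valK. Qed.

Lemma mulS1lE r x :
  mulS1l x (Some r : RQ p n) = obind (fun t => insub (t * val r)) (lift1 x).
Proof. by case: x => [[s|]|] //=; rewrite mul1g valK. Qed.

(** Left multiplication by [g] turns [r * x = r * y] into [s * x = s * y], and [r * t], [s * t] have
    equal height, so they vanish together. The factors range over all partial transformations
    because chosen preimages need not give monotone or decreasing maps. *)
Lemma Lstar_pcomp r s (f g : ptrans n) :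
    val r = pcomp f (val s) :> ptrans n -> val s = pcomp g (val r) :> ptrans n ->
  Lstar (Some r : RQ p n) (Some s).
Proof.
have half r' s' f' g' : val r' = pcomp f' (val s') :> ptrans n ->
    val s' = pcomp g' (val r') :> ptrans n -> forall x y,
    mulS1r (Some r' : RQ p n) x = mulS1r (Some r' : RQ p n) y ->
    mulS1r (Some s' : RQ p n) x = mulS1r (Some s' : RQ p n) y.
  move=> rs sr x y; rewrite !mulS1rE; apply: obind_insub_transfer => [t|t u e].
    congr (_ == _); apply/eqP.
    by rewrite eqn_leq (height_mul_pcompl _ rs) (height_mul_pcompl _ sr).
  by apply: val_inj; rewrite /= sr -!pcompA -!dorp_valM e.
by move=> rs sr x y _ _; split; [apply: half rs sr _ _ | apply: half sr rs _ _].
Qed.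

Lemma Rstar_pcomp r s (f g : ptrans n) :
    val r = pcomp (val s) f :> ptrans n -> val s = pcomp (val r) g :> ptrans n ->
  Rstar (Some r : RQ p n) (Some s).
Proof.
have half r' s' f' g' : val r' = pcomp (val s') f' :> ptrans n ->
    val s' = pcomp (val r') g' :> ptrans n -> forall x y,
    mulS1l x (Some r' : RQ p n) = mulS1l y (Some r' : RQ p n) ->
    mulS1l x (Some s' : RQ p n) = mulS1l y (Some s' : RQ p n).
  move=> rs sr x y; rewrite !mulS1lE; apply: obind_insub_transfer => [t|t u e].
    congr (_ == _); apply/eqP.
    by rewrite eqn_leq (height_mul_pcompr _ rs) (height_mul_pcompr _ sr).
  by apply: val_inj; rewrite /= sr !pcompA -!dorp_valM e.
by move=> rs sr x y _ _; split; [apply: half rs sr _ _ | apply: half sr rs _ _].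
Qed.

Lemma Lstar_pim r s :
  pim (val r) = pim (val s) -> Lstar (Some r : RQ p n) (Some s).
Proof.
move=> eq_im; have [f rs] : exists f : ptrans n, dorp_val (val r) = pcomp f (val s).
  by apply: pim_sub_pcomp; rewrite eq_im.
have [g sr] : exists g : ptrans n, dorp_val (val s) = pcomp g (val r).
  by apply: pim_sub_pcomp; rewrite eq_im.
exact: Lstar_pcomp rs sr.
Qed.

Lemma Lstar_idempotent a : exists2 e, Lstar a e & e * e = e.
Proof.
case: a => [r|]; last by exists None.
pose e := Dorp (pid_on_dorp (pim (val r))).
have he : height e == p by rewrite /height pim_pid_on; exact: (valP r).
exists (Some (Sub e he)).
  by apply: Lstar_pim; rewrite SubK pim_pid_on.
rewrite -[LHS]/(insub (e * e)) (_ : e * e = e) ?insubT //.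
exact/val_inj/pid_on_idem.
Qed.

Lemma Rstar_idempotent a : exists2 e, Rstar a e & e * e = e.
Proof.
case: a => [r|]; last by exists None.
pose e := Dorp (kernel_min_dorp (dorpP (val r))).
have re : val r = pcomp e (val r) :> ptrans n by rewrite kernel_min_comp.
have er : dorp_val e = pcomp (val r) (least_preim (val r)) by [].
have he : height e == p.
  rewrite -(eqP (valP r)) /height eqn_leq {1}er card_pim_pcompl.
  by rewrite {1}re card_pim_pcompl.
exists (Some (Sub e he)); first by apply: (@Rstar_pcomp r (Sub e he) _ _ re er).
rewrite -[LHS]/(insub (e * e)) (_ : e * e = e) ?insubT //.
exact/val_inj/kernel_min_idem.
Qed.

Lemma Dstar_nonzero r s : Dstar (Some r : RQ p n) (Some s).
Proof.
(* Each [c r'] is R*-related to [r'], and all of them share the initial segment of [p] points as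
   image, so they are L*-related to one another. *)
pose c r' := val r' * Dorp (ranking_dorp (pim (val r'))).
have im_c r' : pim (c r') = [set i : 'I_n | i < p].
  rewrite pim_comp_ranking pim_ranking_segment.
  by have /eqP := valP r'; rewrite /height => ->.
have hc r' : height (c r') == p.
  by rewrite /height pim_comp_ranking card_pim_ranking; exact: (valP r').
have Rc r' : Dstar (Some r' : RQ p n) (Some (Sub (c r') (hc r'))).
  have [g rg] := ranking_cancel (val r').
  apply: Rstar_Dstar.
  exact: (@Rstar_pcomp r' (Sub (c r') (hc r')) _ _ rg erefl).
apply: Dstar_trans (Rc r) _; apply: Dstar_trans _ (Dstar_sym (Rc s)).
by apply: Lstar_Dstar; apply: Lstar_pim; rewrite !SubK !im_c.
Qed.

Lemma RQ_abundant : ~ regular_semigroup (RQ p n) -> abundant (RQ p n).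
Proof.
split=> // C [a aC].
  by have [e ae ee] := Lstar_idempotent a; exists e => //; apply/aC.
by have [e ae ee] := Rstar_idempotent a; exists e => //; apply/aC.
Qed.

Lemma RQ_zero_star_bisimple r : zero_star_bisimple (RQ p n).
Proof.
exists (RQ_zero p n); first exact: RQ_zeroP.
have Dstar_r b : b <> RQ_zero p n <-> Dstar (Some r : RQ p n) b.
  case: b => [s|]; first by split=> // _; apply: Dstar_nonzero.
  by split=> // /Dstar_sym/(Dstar_zero RQ_zeroP).
exists (fun b => b <> RQ_zero p n); split; first by exists (Some r).
  by move/(_ (RQ_zero p n)) => [_]; apply.
(* The class of a nonzero element consists of all nonzero elements; that of zero is [{0}], which
   [nzC'] excludes. *)
move=> C' [[s|] aC'] nzC' b.
  apply: iff_trans (aC' b) _; apply: iff_trans _ (iff_sym (Dstar_r b)).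
  by split; apply: Dstar_trans; apply: Dstar_nonzero.
case: nzC' => c; apply: iff_trans (aC' c) _.
by split=> [/(Dstar_zero RQ_zeroP)|->] //; apply: Lstar_Dstar.
Qed.

(* If [r = r s r] and [x r = 0], then [0 s] is defined, hence equal to [0] as [s]
   is decreasing, so that [0] lies in the domain of [r]. *)
Lemma nonregular_of_bottom r (x i0 : 'I_n) :
    i0 = 0%N :> nat -> dorp_val (val r) x = Some i0 -> dorp_val (val r) i0 = None ->
  ~ regular_semigroup (RQ p n).
Proof.
move=> i0_0 rx ri0 /(_ (Some r)) [[s|] //].
rewrite -[X in X * _]/(insub (val r * val s)); case: insubP => // rs _ rsE.
rewrite -[RHS]/(insub (val rs * val r)); case: insubP => // rsr _ rsrE [rE].
have := rx; rewrite rE rsrE rsE => /pcomp_Some[y] /pcomp_Some[z].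
rewrite rx => -[<-] sy ry; have /andP[_ /decreasingP ds] := dorpP (val s).
have /ds := sy; rewrite i0_0 leqn0 => /eqP y0.
by move: ry; rewrite (_ : y = i0) ?ri0 //; apply: val_inj; rewrite /= y0.
Qed.

End ReesTheory.

Theorem theorem2p21 (n p : nat) (hp : (1 <= p <= n - 1)%N) :
  [/\ ~ regular_semigroup (RQ p n),
      zero_star_bisimple (RQ p n)
    & abundant (RQ p n)].
Proof.
have [p_gt0 p_le] := andP hp.
have n_gt0 : 0 < n by case: (n) p_le; rewrite // leqNgt p_gt0.
pose i0 := Ordinal n_gt0.
(* The bound [p <= n - 1] leaves room for [p] points avoiding [i0]. The ranking of such a set has
   height [p], omits [i0] from its domain, and has [i0] in its image because [p >= 1]. *)
have [A] : exists A : {set 'I_n},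
    A \in [set B : {set 'I_n} | B \subset [set~ i0] & #|B| == p].
  apply/card_gt0P; rewrite cards_draws bin_gt0 cardsC1 card_ord.
  by rewrite -subn1.
rewrite inE => /andP[/subsetP A_sub /eqP cardA].
have ht : height (Dorp (ranking_dorp A)) == p by rewrite /height card_pim_ranking cardA.
pose r : {r : dorp n | height r == p} := Sub (Dorp (ranking_dorp A)) ht.
have i0_notin : i0 \notin A by apply/negP => /A_sub; rewrite !inE eqxx.
have /pimP[x rx] : i0 \in pim (ranking A) by rewrite pim_ranking_segment inE cardA.
have nreg : ~ regular_semigroup (RQ p n).
  apply: (@nonregular_of_bottom _ _ r x i0) => //=.
  by rewrite ffunE (negPf i0_notin).
split=> //; [exact: RQ_zero_star_bisimple r | exact: RQ_abundant].
Qed.
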